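(* Let $R$ be a maximal subring of a ring $T$ and $P=(R:T)_r$. If $P$ is a completely prime right ideal of $T$, then $R/P$ is a domain (i.e., $P$ is a completely prime ideal of $R$) and $T/P$ is a torsionfree left $R/P$-module. Conversely, if $P$ is a completely prime ideal of $R$ and $T/P$ is a torsionfree left $R/P$-module, then either $P$ is an ideal of $T$ (and therefore $(R:T)=P$) or $P$ is a completely prime right ideal of $T$ and $R=\mathbb{I}_T(P)$.
   Context: All rings are associative, unital with $1\neq 0$, and not necessarily commutative; subrings contain the identity of the overring. A subring $R\subsetneq T$ is a maximal subring of $T$ if there is no subring $S$ with $R\subsetneq S\subsetneq T$. $(R:T):=\{x\in T\mid TxT\subseteq R\}$ is the largest two-sided ideal of $T$ contained in $R$; $(R:T)_r:=\{x\in T\mid xT\subseteq R\}$ is the largest right ideal of $T$ contained in $R$, and it is a two-sided ideal of $R$. A proper right ideal $P$ of a ring $S$ is a completely prime right ideal if for all $a,b\in S$, $aP\subseteq P$ and $ab\in P$ imply $a\in P$ or $b\in P$. A prime ideal $P$ of a ring $S$ is completely prime if $S/P$ is a domain (no nonzero zero-divisors, not necessarily commutative). A left module $M$ over a domain $D$ is torsionfree if $dm=0$ with $d\in D$, $m\in M$ implies $d=0$ or $m=0$. For a right ideal $A$ of $T$, the idealizer is $\mathbb{I}_T(A):=\{r\in T\mid rA\subseteq A\}$. *)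

(* Defs.v *)
From HB Require Import structures.
From mathcomp Require Import all_boot all_algebra boolp.

Set Implicit Arguments.
Unset Strict Implicit.
Unset Printing Implicit Defensive.

Import GRing.Theory.

Local Open Scope ring_scope.
Local Open Scope quotient_scope.

Section Ideals.
Variable S : nzRingType.

Definition right_ideal (A : {pred S}) : Prop :=
  zmod_closed A /\ (forall x s, x \in A -> x * s \in A).

Definition ideal (A : {pred S}) : Prop :=
  right_ideal A /\ (forall s x, x \in A -> s * x \in A).

Definition completely_prime_right_ideal (A : {pred S}) : Prop :=
  [/\ right_ideal A, ~ (A =i predT) &
      forall a b : S, (forall p, p \in A -> a * p \in A) -> a * b \in A ->
        a \in A \/ b \in A].

(* The products [a * b] generate the product ideal AB additively, so
   AB <= I can be tested on them. *)
Definition prime_ideal (I : {pred S}) : Prop :=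
  [/\ ideal I, ~ (I =i predT) &
      forall A B : {pred S}, ideal A -> ideal B ->
        (forall a b, a \in A -> b \in B -> a * b \in I) ->
        {subset A <= I} \/ {subset B <= I}].

Definition idealizer (A : {pred S}) : pred S :=
  fun r => `[< forall x, x \in A -> r * x \in A >].

End Ideals.

HB.mixin Record isIdealClosed (S : nzRingType) (I : S -> bool) := {
  ideal_mull : forall s x, x \in I -> s * x \in I;
  ideal_mulr : forall x s, x \in I -> x * s \in I
}.

#[short(type="idealClosed")]
HB.structure Definition IdealClosed (S : nzRingType) :=
  {I of GRing.ZmodClosed S I & isIdealClosed S I}.

(* [ring_quotient] only provides ring quotients of commutative rings. The
   alias [ring_quot] of its additive quotient carries the ring structure of
   S / I for any S. It is only a [pzRingType], as I need not be proper. *)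
Section RingQuotient.
Variables (S : nzRingType) (I : idealClosed S).

Definition ring_quot : Type := Quotient.quot I.
HB.instance Definition _ := GRing.Zmodule.on ring_quot.
HB.instance Definition _ := EqQuotient.on ring_quot.

Local Notation piI := (\pi_ring_quot).

Definition ring_quot_one : ring_quot := piI 1.
Definition ring_quot_mul (x y : ring_quot) : ring_quot :=
  piI (repr x * repr y).

Lemma ring_quot_eqP (x y : S) : reflect (piI x = piI y) (x - y \in I).
Proof. by rewrite Quotient.idealrBE; exact: eqP. Qed.

Lemma ring_quot_reprB (x : S) : repr (piI x) - x \in I.
Proof. by apply/ring_quot_eqP; rewrite reprK. Qed.

Lemma ring_quot_piD (x y : S) : piI (x + y) = piI x + piI y.
Proof. exact: (@Quotient.pi_add S I). Qed.

Lemma ring_quot_piM (x y : S) : piI (x * y) = ring_quot_mul (piI x) (piI y).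
Proof.
apply/esym/ring_quot_eqP.
rewrite -[_ * _](addrNK (x * repr (piI y))) -addrA -mulrBl -mulrBr rpredD //.
  exact/ideal_mulr/ring_quot_reprB.
exact/ideal_mull/ring_quot_reprB.
Qed.

Lemma ring_quot_mulA : associative ring_quot_mul.
Proof.
move=> x y z; rewrite -[x]reprK -[y]reprK -[z]reprK.
by rewrite -(ring_quot_piM (repr x) (repr y)) -(ring_quot_piM (repr y) (repr z))
  -!ring_quot_piM mulrA.
Qed.

Lemma ring_quot_mul1l : left_id ring_quot_one ring_quot_mul.
Proof. by move=> x; rewrite -[x]reprK -ring_quot_piM mul1r. Qed.

Lemma ring_quot_mul1r : right_id ring_quot_one ring_quot_mul.
Proof. by move=> x; rewrite -[x]reprK -ring_quot_piM mulr1. Qed.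

Lemma ring_quot_mulDl : left_distributive ring_quot_mul +%R.
Proof.
move=> x y z; rewrite -[x]reprK -[y]reprK -[z]reprK.
by rewrite -ring_quot_piD -!ring_quot_piM -ring_quot_piD mulrDl.
Qed.

Lemma ring_quot_mulDr : right_distributive ring_quot_mul +%R.
Proof.
move=> x y z; rewrite -[x]reprK -[y]reprK -[z]reprK.
by rewrite -ring_quot_piD -!ring_quot_piM -ring_quot_piD mulrDr.
Qed.

HB.instance Definition _ := GRing.Zmodule_isPzRing.Build ring_quot
  ring_quot_mulA ring_quot_mul1l ring_quot_mul1r ring_quot_mulDl
  ring_quot_mulDr.

End RingQuotient.

(* [idomainType] is commutative, hence this predicate. *)
Definition is_domain (D : pzRingType) : Prop :=
  (1 : D) <> 0 /\ forall a b : D, a * b = 0 -> a = 0 \/ b = 0.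

Definition completely_prime_ideal (S : nzRingType) (I : idealClosed S) : Prop :=
  prime_ideal I /\ is_domain (ring_quot I).

Definition torsionfree (D : pzRingType) (M : lmodType D) : Prop :=
  forall (d : D) (m : M), d *: m = 0 -> d = 0 \/ m = 0.

Section Subring.
Variables (T : nzRingType) (R : subringClosed T).

Definition subring : Type := {x : T | x \in R}.
HB.instance Definition _ := SubChoice.on subring.
HB.instance Definition _ := [SubChoice_isSubNzRing of subring by <:].

Definition proper_subset (A B : {pred T}) : Prop :=
  {subset A <= B} /\ ~ {subset B <= A}.

Definition maximal_subring : Prop :=
  proper_subset R predT /\
  ~ exists S : subringClosed T, proper_subset R S /\ proper_subset S predT.

(* (R : T) *)
Definition conductor : pred T := fun x => `[< forall s t, s * x * t \in R >].

(* (R : T)_r *)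
Definition rconductor : pred T := fun x => `[< forall t, x * t \in R >].

Lemma rconductorP x : reflect (forall t, x * t \in R) (x \in rconductor).
Proof. exact: asboolP. Qed.

Lemma rconductor_zmod_closed : zmod_closed rconductor.
Proof.
split=> [|x y /rconductorP xR /rconductorP yR]; apply/rconductorP => t.
  by rewrite mul0r rpred0.
by rewrite mulrBl rpredB.
Qed.

HB.instance Definition _ := GRing.isZmodClosed.Build T rconductor
  rconductor_zmod_closed.

Lemma rconductor_mulr x t : x \in rconductor -> x * t \in rconductor.
Proof. by move=> /rconductorP xR; apply/rconductorP => u; rewrite -mulrA. Qed.

Lemma rconductor_mull r x :
  r \in R -> x \in rconductor -> r * x \in rconductor.
Proof.
by move=> rR /rconductorP xR; apply/rconductorP => u; rewrite -mulrA rpredM.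
Qed.

(* (R : T)_r, which is contained in R, as a subset of the ring R. *)
Definition rconductor_in : pred subring := fun x => val x \in rconductor.

Lemma rconductor_in_zmod_closed : zmod_closed rconductor_in.
Proof.
by split=> [|x y xP yP]; rewrite unfold_in /rconductor_in
  ?raddf0 ?rpred0 // raddfB rpredB.
Qed.

HB.instance Definition _ := GRing.isZmodClosed.Build subring rconductor_in
  rconductor_in_zmod_closed.

Lemma rconductor_in_mull s x : x \in rconductor_in -> s * x \in rconductor_in.
Proof. by move=> xP; apply: rconductor_mull => //; exact: valP. Qed.

Lemma rconductor_in_mulr x s : x \in rconductor_in -> x * s \in rconductor_in.
Proof. by move=> xP; apply: rconductor_mulr. Qed.

HB.instance Definition _ := isIdealClosed.Build subring rconductor_in
  rconductor_in_mull rconductor_in_mulr.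

Definition rconductor_ideal : idealClosed subring :=
  IdealClosed.clone subring rconductor_in _.

(* The left R / P-module T / P, for P = (R : T)_r, with scaling
   (r + P) (t + P) = r t + P (lemma [module_quot_piZ]). *)
Definition module_quot : Type := Quotient.quot (GRing.ZmodClosed.clone T rconductor _).
HB.instance Definition _ := GRing.Zmodule.on module_quot.
HB.instance Definition _ := EqQuotient.on module_quot.

Local Notation RP := (ring_quot rconductor_ideal).
Local Notation piR := (\pi_(ring_quot rconductor_ideal)).
Local Notation piT := (\pi_module_quot).

Definition module_quot_scale (d : RP) (m : module_quot) : module_quot :=
  piT (val (repr d) * repr m).

Lemma module_quot_eqP (x y : T) :
  reflect (piT x = piT y) (x - y \in rconductor).
Proof. by rewrite Quotient.idealrBE; exact: eqP. Qed.

Lemma module_quot_reprB (x : T) : repr (piT x) - x \in rconductor.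
Proof. by apply/module_quot_eqP; rewrite reprK. Qed.

Lemma module_quot_piD (x y : T) : piT (x + y) = piT x + piT y.
Proof. exact: (@Quotient.pi_add T _). Qed.

Lemma module_quot_scaleE (r : subring) (t : T) :
  module_quot_scale (piR r) (piT t) = piT (val r * t).
Proof.
apply/module_quot_eqP.
rewrite -[_ * _](addrNK (val r * repr (piT t))) -addrA -mulrBl -mulrBr.
rewrite rpredD //.
  rewrite rconductor_mulr // -raddfB.
  exact: (ring_quot_reprB rconductor_ideal).
by rewrite rconductor_mull ?module_quot_reprB //; exact: valP.
Qed.

Lemma module_quot_scaleA (a b : RP) m :
  module_quot_scale a (module_quot_scale b m) = module_quot_scale (a * b) m.
Proof.
rewrite -[a]reprK -[b]reprK -[m]reprK -[piR _ * piR _]ring_quot_piM.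
rewrite (module_quot_scaleE (repr b) (repr m)) (module_quot_scaleE (repr a)).
by rewrite (module_quot_scaleE (repr a * repr b)) rmorphM mulrA.
Qed.

Lemma module_quot_scale1 : left_id 1 module_quot_scale.
Proof.
by move=> m; rewrite -[m]reprK module_quot_scaleE rmorph1 mul1r.
Qed.

Lemma module_quot_scaleDr : right_distributive module_quot_scale +%R.
Proof.
move=> a m n; rewrite -[a]reprK -[m]reprK -[n]reprK -module_quot_piD.
by rewrite !module_quot_scaleE -module_quot_piD mulrDr.
Qed.

Lemma module_quot_scaleDl m :
  {morph module_quot_scale^~ m : a b / a + b}.
Proof.
move=> a b; rewrite -[a]reprK -[b]reprK -[m]reprK -ring_quot_piD.
by rewrite !module_quot_scaleE -module_quot_piD raddfD mulrDl.
Qed.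

HB.instance Definition _ := GRing.Zmodule_isLmodule.Build RP module_quot
  module_quot_scaleA module_quot_scale1 module_quot_scaleDr
  module_quot_scaleDl.

Lemma module_quot_piZ (r : subring) (t : T) :
  piR r *: piT t = piT (val r * t).
Proof. exact: module_quot_scaleE. Qed.

End Subring.

(* Main.v *)
Require Import Defs.
From HB Require Import structures.
From mathcomp Require Import all_boot all_algebra boolp.

(** Write P for the largest right ideal of T contained in R. Both halves rest
    on the fact that, for r in R and t in T, the scalar r + P kills t + P in
    T / P exactly when r t lies in P; so T / P is torsionfree exactly when
    r t in P forces r in P or t in P ([torsionfree_module_quotP]).

    Since P is a left ideal of R, every r in R satisfies r P <= P. A
    completely prime right ideal P therefore satisfies this criterion, and
    restricting the criterion to t in R says that R / P is a domain. For the
    converse, the idealizer of P is a subring of T containing R, so by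
    maximality it is T or R ([maximal_subring_idealizer]). In the first case P
    is a two-sided ideal of T. In the second, a P <= P forces a in R, so the
    criterion is precisely complete primality of P. In both halves P is proper
    because 1 in P would give T <= R. *)

Import GRing.Theory.
Local Open Scope ring_scope.
Local Open Scope quotient_scope.

Section Idealizer.
Variables (S : nzRingType) (A : zmodClosed S).

Lemma idealizerP (r : S) :
  reflect (forall x, x \in A -> r * x \in A) (r \in idealizer A).
Proof. exact: asboolP. Qed.

Lemma idealizer_subring_closed : subring_closed (idealizer A).
Proof.
split=> [|r s /idealizerP rA /idealizerP sA|r s /idealizerP rA /idealizerP sA].
- by apply/idealizerP => x xA; rewrite mul1r.
- by apply/idealizerP => x xA; rewrite mulrBl rpredB ?rA ?sA.
- by apply/idealizerP => x xA; rewrite -mulrA rA ?sA.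
Qed.

HB.instance Definition _ :=
  GRing.isSubringClosed.Build S (idealizer A) idealizer_subring_closed.

(** The idealizer of [A], bundled as a subring of [S]. *)
Definition idealizer_subring : subringClosed S :=
  GRing.SubringClosed.clone S (idealizer A) _.

End Idealizer.

Section Quotients.
Variables (S : nzRingType) (I : idealClosed S).

Lemma ring_quot_pi_eq0 (x : S) : (\pi_(ring_quot I) x = 0) <-> x \in I.
Proof.
have pi0 : \pi_(ring_quot I) 0 = 0.
  by apply: (@addrI _ (\pi_(ring_quot I) 0)); rewrite -ring_quot_piD !addr0.
by rewrite -pi0 -{2}[x]subr0; split=> /ring_quot_eqP.
Qed.

Lemma is_domain_ring_quot :
  1 \notin I -> (forall a b, a * b \in I -> a \in I \/ b \in I) ->
  is_domain (ring_quot I).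
Proof.
move=> I1 Icp; split=> [/ring_quot_pi_eq0|x y]; first exact/negP.
rewrite -[x]reprK -[y]reprK -[_ * _]ring_quot_piM => /ring_quot_pi_eq0/Icp.
by case=> /ring_quot_pi_eq0; [left | right].
Qed.

Lemma prime_ideal_of_elements :
  1 \notin I -> (forall a b, a * b \in I -> a \in I \/ b \in I) ->
  prime_ideal I.
Proof.
move=> I1 Icp; split.
- split; last exact: ideal_mull.
  split; last exact: ideal_mulr.
  by split; [exact: rpred0 | exact: rpredB].
- by move=> IT; rewrite IT in I1.
move=> A B _ _ ABI; case: (pselect {subset A <= I}) => [|nAI]; first by left.
right=> b bB; apply: contrapT => nbI; apply: nAI => a aA.
by case: (Icp a b (ABI a b aA bB)).
Qed.

End Quotients.

Section MaximalSubring.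
Variables (T : nzRingType) (R : subringClosed T).

Lemma rconductor_right_ideal : right_ideal (rconductor R).
Proof.
by split; [exact: rconductor_zmod_closed | exact: rconductor_mulr].
Qed.

Lemma module_quot_pi_eq0 (t : T) :
  (\pi_(module_quot R) t = 0) <-> t \in rconductor R.
Proof.
have pi0 : \pi_(module_quot R) 0 = 0.
  by apply: (@addrI _ (\pi_(module_quot R) 0)); rewrite -module_quot_piD !addr0.
by rewrite -pi0 -{2}[t]subr0; split=> /module_quot_eqP.
Qed.

Lemma torsionfree_module_quotP :
  torsionfree (module_quot R : lmodType (ring_quot (rconductor_ideal R))) <->
  (forall r t, r \in R -> r * t \in rconductor R ->
     r \in rconductor R \/ t \in rconductor R).
Proof.
split=> [tf r t rR rtP|tf d m].
  pose r' : subring R := Sub r rR.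
  have [|/ring_quot_pi_eq0|/module_quot_pi_eq0] :=
    tf (\pi_(ring_quot (rconductor_ideal R)) r') (\pi_(module_quot R) t).
  - by rewrite module_quot_piZ; apply/module_quot_pi_eq0; rewrite SubK.
  - by left.
  - by right.
rewrite -[d]reprK -[m]reprK module_quot_piZ => /module_quot_pi_eq0.
case/(tf _ _ (valP _)) => [dP|/module_quot_pi_eq0]; last by right.
by left; apply/ring_quot_pi_eq0.
Qed.

Lemma sub_idealizer_rconductor : {subset R <= idealizer (rconductor R)}.
Proof. by move=> r rR; apply/idealizerP => x; apply: rconductor_mull. Qed.

Lemma conductor_eq_rconductor :
  ideal (rconductor R) -> conductor R =i rconductor R.
Proof.
move=> [_ Pl] x; apply/idP/idP => [/asboolP xR|xP].
  by apply/rconductorP => t; rewrite -[x]mul1r.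
by apply/asboolP => s t; move: t; apply/rconductorP/Pl.
Qed.

Hypothesis maxR : maximal_subring R.

Lemma rconductor_not1 : 1 \notin rconductor R.
Proof.
apply/negP => /rconductorP R1; case: maxR => -[_ nTR] _.
by apply: nTR => x _; rewrite -[x]mul1r.
Qed.

Lemma maximal_subring_idealizer :
  idealizer (rconductor R) =i predT \/ R =i idealizer (rconductor R).
Proof.
have [sTI|nTI] := pselect {subset predT <= idealizer (rconductor R)}.
  by left=> x; rewrite sTI.
have [sIR|nIR] := pselect {subset idealizer (rconductor R) <= R}.
  right=> x; apply/idP/idP; last exact: sIR.
  exact: sub_idealizer_rconductor.
pose P := GRing.ZmodClosed.clone T (rconductor R) _.
case: maxR => _ []; exists (idealizer_subring T P).
by do 2![split=> //]; apply: sub_idealizer_rconductor.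
Qed.

End MaximalSubring.

Theorem proposition2p9 (T : nzRingType) (R : subringClosed T)
    (maxR : maximal_subring R) :
  (completely_prime_right_ideal (rconductor R) ->
     completely_prime_ideal (rconductor_ideal R) /\
     torsionfree (module_quot R : lmodType (ring_quot (rconductor_ideal R))))
  /\
  (completely_prime_ideal (rconductor_ideal R) ->
   torsionfree (module_quot R : lmodType (ring_quot (rconductor_ideal R))) ->
     (ideal (rconductor R) /\ conductor R =i rconductor R) \/
     (completely_prime_right_ideal (rconductor R) /\
      R =i idealizer (rconductor R))).
Proof.
have P1 := rconductor_not1 T R maxR.
split=> [[_ _ Pcp]|_ /torsionfree_module_quotP tf].
  have tf r t : r \in R -> r * t \in rconductor R ->
      r \in rconductor R \/ t \in rconductor R.
    by move=> rR; apply: Pcp => p; apply: rconductor_mull.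
  have Q1 : 1 \notin rconductor_ideal R by exact: P1.
  have Qcp (a b : subring R) : a * b \in rconductor_ideal R ->
      a \in rconductor_ideal R \/ b \in rconductor_ideal R.
    by move=> abP; apply: (tf (val a) (val b) (valP a)).
  split; last exact/torsionfree_module_quotP.
  by split; [apply: prime_ideal_of_elements | apply: is_domain_ring_quot].
have [IT|RI] := maximal_subring_idealizer T R maxR; [left|right].
  have Pideal : ideal (rconductor R).
    split=> [|s x]; first exact: rconductor_right_ideal.
    by move: x; apply/idealizerP; rewrite IT.
  by split; [|exact: conductor_eq_rconductor].
split=> //; split=> [|PT|a b aP]; first exact: rconductor_right_ideal.
  by rewrite PT in P1.
by apply: tf; rewrite RI; apply/idealizerP.
Qed.
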